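(* Let $m\ge 2$ be an integer and $A,B\in\mathbb{Z}_m$. If the homogeneous equation $$BX_{n+1}=AX_n,\quad n\in\mathbb{Z}_+,$$ has only the trivial solution in $\mathbb{Z}_m$, then for any sequence $\{F_n\}_{n=0}^\infty$ in $\mathbb{Z}_m$ the equation $$BX_{n+1}=AX_n+F_n,\quad n\in\mathbb{Z}_+,$$ has a unique solution $\{X_n\}_{n=0}^\infty$ in $\mathbb{Z}_m$. Moreover, this unique solution has the form $$X_n=-\sum_{s=0}^{\mathrm{ind}(B)-1}A^{-s-1}B^sF_{n+s},\quad n\in\mathbb{Z}_+.$$
   Context: $\mathbb{Z}_+$ is the set of non-negative integers and $\mathbb{Z}_m=\mathbb{Z}/m\mathbb{Z}$. For a nilpotent element $T$, $\mathrm{ind}(T)$ is its nilpotency index (least $k\ge1$ with $T^k=0$). Zeroth powers are $1$. The formula makes sense: under the hypothesis on the homogeneous equation, $A$ is invertible and $B$ is nilpotent in $\mathbb{Z}_m$. *)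

(* Defs.v *)
From mathcomp Require Import all_boot all_order all_algebra.
Set Implicit Arguments.
Unset Strict Implicit.
Unset Printing Implicit Defensive.
Import GRing.Theory.
Local Open Scope ring_scope.

Definition nilpotent_elt (R : nzRingType) (T : R) : Prop :=
  exists k : nat, (0 < k)%N && (T ^+ k == 0).

(* The value does not depend on the proof of nilpotency. *)
Definition ind (R : nzRingType) (T : R) (hT : nilpotent_elt T) : nat :=
  ex_minn hT.

Definition solves_homogeneous (R : nzRingType) (A B : R) (X : nat -> R) : Prop :=
  forall n : nat, B * X n.+1 = A * X n.

Definition solves (R : nzRingType) (A B : R) (F X : nat -> R) : Prop :=
  forall n : nat, B * X n.+1 = A * X n + F n.

(* Main.v *)
(** If [A x = 0] then [(x, 0, 0, ...)] solves the homogeneous equation, so [A]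
    is injective, hence a unit, by finiteness.  Finiteness also gives
    [B^(i+p) = B^i] with [p > 0]; then [X_n = (A B^(p-1))^n B^i] solves the
    homogeneous equation, and [X_0 = 0] says that [B] is nilpotent.  Iterating
    [X_n = A^-1 (B X_(n+1) - F_n)] until the power of [B] vanishes yields the
    formula, and the formula telescopes to a solution. *)
Require Import Defs.
From mathcomp Require Import all_boot all_order all_algebra.
From mathcomp Require Import ring.
From Stdlib Require Import FunctionalExtensionality.
Set Implicit Arguments.
Unset Strict Implicit.
Unset Printing Implicit Defensive.
Import GRing.Theory.
Local Open Scope ring_scope.

(** Pigeonhole: the [#|R|.+1] powers with exponents from 0 to [#|R|] cannot be distinct. *)
Lemma exprn_eventually_periodic (R : finNzRingType) (x : R) :
  exists i p : nat, x ^+ (i + p.+1) = x ^+ i.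
Proof.
pose f (i : 'I_#|R|.+1) := x ^+ i.
have /injectivePn [i [j ne_ij eq_ij]] : ~~ injectiveb f.
  by apply/injectiveP => /leq_card; rewrite card_ord ltnn.
wlog lt_ij : i j ne_ij eq_ij / (i < j)%N.
  move=> th; case: (ltngtP i j) => [lt_ij|lt_ji|/val_inj eq].
  - exact: th lt_ij.
  - by apply: th lt_ji => //; rewrite eq_sym.
  - by rewrite eq eqxx in ne_ij.
by exists i, (j - i).-1; rewrite prednK ?subn_gt0 // subnKC ?(ltnW lt_ij).
Qed.

Lemma ind_exp0 (R : nzRingType) (T : R) (hT : nilpotent_elt T) :
  T ^+ ind hT = 0.
Proof. by rewrite /ind; case: ex_minnP => k /andP[_ /eqP]. Qed.

Section HomogeneousTrivial.

Variables (R : finComUnitRingType) (A B : R).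
Hypothesis hom_trivial : forall X : nat -> R,
  solves_homogeneous A B X -> forall n : nat, X n = 0.

Lemma hom_trivial_unit : A \is a GRing.unit.
Proof.
have A_inj : injective ( *%R A).
  move=> x y eq_xy; apply/eqP; rewrite -subr_eq0; apply/eqP.
  apply: (hom_trivial (X := fun n => if n is 0 then x - y else 0) _ 0) => -[|n].
    by rewrite mulr0 mulrBr eq_xy subrr.
  by rewrite !mulr0.
by apply/unitrPr; exists (invF A_inj 1); apply: (f_invF A_inj).
Qed.

Lemma hom_trivial_nilpotent : nilpotent_elt B.
Proof.
have [i [p Bip]] := exprn_eventually_periodic B.
(* [i] may be 0, whereas [nilpotent_elt] asks for a positive exponent. *)
exists i.+1; rewrite exprSr.
suff -> : B ^+ i = 0 by rewrite mul0r eqxx.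
(* [1 * B ^+ i] is the term at 0 of the sequence below. The period being [p.+1], one factor [B]
   completes [B ^+ p] to a full period. *)
rewrite -[LHS]mul1r.
apply: (hom_trivial (X := fun n => (A * B ^+ p) ^+ n * B ^+ i) _ 0) => n.
by rewrite -[in RHS]Bip addnC exprD !exprS; ring.
Qed.

End HomogeneousTrivial.

Section InhomogeneousEquation.

Variables (R : comUnitRingType) (A B : R) (F : nat -> R).
Hypothesis A_unit : A \is a GRing.unit.

(** Induction on [k]: solving the equation at [n + k] for [X (n + k)] splits off the summand
    [s = k]. *)
Lemma solves_iterate (X : nat -> R) : solves A B F X -> forall k n : nat,
  X n = A ^- k * B ^+ k * X (n + k)%N
        - \sum_(0 <= s < k) A ^- s.+1 * B ^+ s * F (n + s)%N.
Proof.
move=> solX; elim=> [|k IHk] n.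
  by rewrite big_nil subr0 !expr0 invr1 !mul1r addn0.
rewrite IHk big_nat_recr //= opprD addrA addrAC; congr (_ - _).
have -> : X (n + k)%N = A^-1 * (B * X (n + k.+1)%N - F (n + k)%N).
  by rewrite addnS solX addrK mulKr.
by rewrite -!exprVn !exprS; ring.
Qed.

Lemma solves_nilpotent_sum (k : nat) : B ^+ k = 0 ->
  solves A B F
    (fun n => - \sum_(0 <= s < k) A ^- s.+1 * B ^+ s * F (n + s)%N).
Proof.
move=> Bk0 n; rewrite !mulrN; apply/eqP.
rewrite -[_ + F n]opprK eqr_opp opprD opprK !mulr_sumr; apply/eqP.
have A_term s : A * (A ^- s.+1 * B ^+ s * F (n + s)%N)
              = A ^- s * B ^+ s * F (n + s)%N.
  by rewrite -!exprVn exprS -!mulrA mulVKr.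
under [in RHS]eq_bigr => s _ do rewrite A_term.
apply: (addIr (F n)); rewrite subrK.
(* The extra term [s = k] vanishes since [B ^+ k = 0]; the term [s = 0] is [F n], and the others,
   reindexed, are those of the left-hand sum. *)
transitivity (\sum_(0 <= s < k.+1) A ^- s * B ^+ s * F (n + s)%N); last first.
  by rewrite big_nat_recr //= Bk0 mulr0 mul0r addr0.
rewrite big_nat_recl //= !expr0 invr1 !mul1r addn0 addrC; congr (_ + _).
by apply: eq_bigr => s _; rewrite addSnnS [B ^+ s.+1]exprS; ring.
Qed.

End InhomogeneousEquation.

Theorem corollary3p4 (m : nat) (hm : (2 <= m)%N) (A B : 'Z_m)
    (hom_trivial : forall X : nat -> 'Z_m,
       solves_homogeneous A B X -> forall n : nat, X n = 0) :
  A \is a GRing.unit /\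
  exists hB : nilpotent_elt B,
    forall F : nat -> 'Z_m,
      (exists! X : nat -> 'Z_m, solves A B F X) /\
      (forall X : nat -> 'Z_m, solves A B F X ->
         forall n : nat,
           X n = - \sum_(0 <= s < ind hB) A ^- s.+1 * B ^+ s * F (n + s)%N).
Proof.
have A_unit := hom_trivial_unit hom_trivial.
split=> //; exists (hom_trivial_nilpotent hom_trivial) => F.
set hB := hom_trivial_nilpotent _.
have formula X : solves A B F X -> forall n,
    X n = - \sum_(0 <= s < ind hB) A ^- s.+1 * B ^+ s * F (n + s)%N.
  move=> solX n; rewrite (solves_iterate A_unit solX (ind hB)) ind_exp0.
  by rewrite mulr0 mul0r add0r.
split=> //.
(* The formula is itself the witness; as it determines every solution pointwise, it also gives
   uniqueness. *)
exists (fun n => - \sum_(0 <= s < ind hB) A ^- s.+1 * B ^+ s * F (n + s)%N).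
split; first by apply: solves_nilpotent_sum => //; apply: ind_exp0.
by move=> X solX; apply: functional_extensionality => n; rewrite formula.
Qed.
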